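(* Let $M$ be a matroid of rank $k$ on an $n$-element ground set $E$. Then, as rational functions, \[t_{M}(X,Y)=(X-1)^{-(n-k)}X^{n}\,W_{M}\big(1,X^{-1},(X-1)(Y-1)\big).\]
   Context: For a matroid $M$ on $E$ with rank function $r$, the nullity is $n_M(\sigma)=|\sigma|-r(\sigma)$. The Tutte polynomial is $t_M(X,Y)=\sum_{\sigma\subseteq E}(X-1)^{r(E)-r(\sigma)}(Y-1)^{|\sigma|-r(\sigma)}$. Generalized weight polynomials: $P_{M,0}(Z)=1$ and, for $1\le j\le n$, $P_{M,j}(Z)=(-1)^j\sum_{|\sigma|=j}\sum_{\gamma\subseteq\sigma}(-1)^{|\gamma|}Z^{n_M(\gamma)}$ (sums over subsets of $E$). The enumerator of $M$ is $W_M(X,Y,Z)=\sum_{i=0}^{n}P_{M,i}(Z)X^{n-i}Y^i$. *)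

(* Defs.v *)
From HB Require Import structures.
From mathcomp Require Import all_boot all_order all_algebra.
From mathcomp Require Export mpoly.

Set Implicit Arguments.
Unset Strict Implicit.
Unset Printing Implicit Defensive.

Import GRing.Theory.
Local Open Scope ring_scope.

Record matroid (E : finType) := Matroid {
  indep : {set {set E}};
  indep_set0 : set0 \in indep;
  indep_sub : forall A B : {set E},
    A \subset B -> B \in indep -> A \in indep;
  indep_augment : forall A B : {set E},
    A \in indep -> B \in indep -> (#|A| < #|B|)%N ->
    exists2 x, x \in B :\: A & x |: A \in indep
}.

Section MatroidPolynomials.

Variables (E : finType) (M : matroid E).

Definition rank (s : {set E}) : nat :=
  \max_(A in indep M | A \subset s) #|A|.

(* The truncated subtractions here and in [tutte] are genuine ones, since
   rank s <= #|s| and rank s <= rank [set: E]. *)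
Definition nullity (s : {set E}) : nat := (#|s| - rank s)%N.

(* The numerals indexing the indeterminates below are elements of 'I_2 and
   'I_3: X and Y are 'X_0 and 'X_1, and Z is 'X_2 in [enumerator]. *)
Definition tutte : {mpoly int[2]} :=
  \sum_(s : {set E})
    ('X_0 - 1) ^+ (rank [set: E] - rank s) * ('X_1 - 1) ^+ (#|s| - rank s).

Definition gweight (j : nat) : {poly int} :=
  if j == 0%N then 1 else
  (-1) ^+ j * \sum_(s : {set E} | #|s| == j) \sum_(g : {set E} | g \subset s)
                (-1) ^+ #|g| * 'X^(nullity g).

Definition enumerator : {mpoly int[3]} :=
  \sum_(i < #|E|.+1)
    (map_poly (@mpolyC 3 int) (gweight i)).['X_2]
      * 'X_0 ^+ (#|E| - i) * 'X_1 ^+ i.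

End MatroidPolynomials.

Notation ratfun := {fraction {mpoly int[2]}}.

Definition enumerator_at (E : finType) (M : matroid E) (x y z : ratfun) :
    ratfun :=
  (map_mpoly intr (enumerator M)).@[tnth [tuple x; y; z]].

(* Main.v *)
(** Exchanging the two sums over g \subset s in X^n W_M(1, 1/X, Z), the inner
    sum of (-1)^(|s| - |g|) X^(n - |s|) over the sets s containing g is
    (X - 1)^(n - |g|).  For Z = (X - 1)(Y - 1) the term of g is then
    (X - 1)^(n - r(g)) (Y - 1)^(|g| - r(g)), that is, (X - 1)^(n - k) times the
    term of g in the Tutte polynomial. *)

Require Import Defs.
From mathcomp Require Import all_boot all_order all_algebra.
Import GRing.Theory.
Local Open Scope ring_scope.

Lemma rank_le_card (E : finType) (M : matroid E) (s : {set E}) :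
  (rank M s <= #|s|)%N.
Proof. by apply/bigmax_leqP => A /andP[_ /subset_leq_card]. Qed.

Lemma rank_subset (E : finType) (M : matroid E) (s t : {set E}) :
  s \subset t -> (rank M s <= rank M t)%N.
Proof.
move=> st; apply/bigmax_leqP => A /andP[AM As].
apply: (leq_bigmax_cond (F := fun B : {set E} => #|B|)).
by rewrite AM (subset_trans As).
Qed.

(** Binomial expansion over the subsets [s :\: g] of the complement of [g]. The exponent
    [#|s| + #|g|] has the parity of [#|s :\: g|] and avoids a truncated subtraction. *)
Lemma sum_supset_signed_exp (R : comNzRingType) (E : finType) (g : {set E})
    (x : R) :
  \sum_(s : {set E} | g \subset s) (-1) ^+ (#|s| + #|g|) * x ^+ (#|E| - #|s|)
  = (x - 1) ^+ (#|E| - #|g|).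
Proof.
(* With these factors, the expansion of [\prod_i (F i + G i)] over subsets s
   has no contribution from those s not containing g. *)
pose F i : R := if i \in g then 1 else -1.
pose G i : R := if i \in g then 0 else x.
have cardC (s : {set E}) : (#|E| - #|s|)%N = #|~: s|.
  by rewrite [in RHS]cardsCs setCK.
have -> : (x - 1) ^+ (#|E| - #|g|) = \prod_i (F i + G i).
  rewrite (bigID (mem g)) /= big1 ?mul1r => [|i ig]; last first.
    by rewrite /F /G ig addr0.
  rewrite (eq_bigr (fun=> x - 1)) => [|i /negbTE ig]; last first.
    by rewrite /F /G ig addrC.
  rewrite prodr_const cardC; congr (_ ^+ _).
  by apply: eq_card => i; rewrite !inE.
transitivity (\sum_(s : {set E}) \prod_i (if i \in s then F i else G i));
  last by rewrite bigA_distr.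
rewrite [RHS](bigID (fun s : {set E} => g \subset s)) /=.
rewrite [X in _ = _ + X]big1 ?addr0 => [|s /subsetPn[i ig /negbTE is_]];
  last first.
  by rewrite (bigD1 i) //= is_ /G ig mul0r.
(* For [s] containing [g], each element of [g] contributes 1, each element of [s :\: g] contributes
   -1, and each element outside [s] contributes [x]. *)
apply: eq_bigr => s gs; rewrite (bigID (mem s)) /=; congr (_ * _).
  rewrite (bigID (mem g)) /= big1 ?mul1r => [|i /andP[is_ ig]]; last first.
    by rewrite is_ /F ig.
  rewrite (eq_bigr (fun=> -1)) => [|i /andP[is_ /negbTE ig]]; last first.
    by rewrite is_ /F ig.
 rewrite prodr_const [in RHS](eq_card (B := s :\: g)) => [|i]; last first.
    by rewrite !inE andbC.
  rewrite -(cardsID g s) (setIidPr gs) addnAC addnn exprD -muln2 exprM.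
  by rewrite sqrr_sign mul1r.
rewrite (eq_bigr (fun=> x)) => [|i is_]; last first.
  rewrite (negbTE is_) /G ifN //.
  by apply: contra is_; apply: (subsetP gs).
rewrite prodr_const cardC; congr (_ ^+ _).
by apply: eq_card => i; rewrite !inE.
Qed.

(** The separate clause for [j = 0] agrees with the general formula: only the empty set occurs
    there, with nullity 0. *)
Lemma gweightE (E : finType) (M : matroid E) (j : nat) :
  gweight M j = (-1) ^+ j * \sum_(s : {set E} | #|s| == j)
    \sum_(g : {set E} | g \subset s) (-1) ^+ #|g| * 'X^(nullity M g).
Proof.
rewrite /gweight; case: eqP => // ->.
rewrite (big_pred1 set0) => [|s]; last by rewrite /= cards_eq0.
rewrite (big_pred1 set0) => [|s]; last by rewrite /= subset0.
by rewrite /nullity cards0 sub0n !expr0 !mulr1.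
Qed.

(** Grouping the sets [s] by cardinality merges the sum over [i] with the sums inside the
    weights. *)
Lemma rmorph_enumerator (E : finType) (M : matroid E) (R : comNzRingType)
    (f : {rmorphism {mpoly int[3]} -> R}) :
  f (enumerator M) =
  \sum_(s : {set E}) \sum_(g : {set E} | g \subset s)
    (-1) ^+ (#|s| + #|g|) * f 'X_2 ^+ nullity M g
      * (f 'X_0 ^+ (#|E| - #|s|) * f 'X_1 ^+ #|s|).
Proof.
have card_lt (s : {set E}) : (#|s| < #|E|.+1)%N by rewrite ltnS max_card.
rewrite (partition_big (fun s => Ordinal (card_lt s)) predT) //=.
rewrite /enumerator rmorph_sum; apply: eq_bigr => i _.
(* Packaging the substitution for Z as one ring morphism lets it pass through the sums, signs and
   powers in [gweight]. *)
pose h : {rmorphism {poly int} -> R} :=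
  f \o (horner_eval 'X_2 \o map_poly (@mpolyC 3 int)).
have hX : h 'X = f 'X_2 by rewrite /h /= /horner_eval map_polyX hornerX.
rewrite !rmorphM !rmorphXn -[f _]/(h (gweight M i)) gweightE.
rewrite rmorphM rmorph_sign !rmorph_sum -mulrA mulr_sumr mulr_suml.
apply: eq_big => [s|s /eqP cs]; first by rewrite -val_eqE.
rewrite rmorph_sum mulr_sumr mulr_suml; apply: eq_bigr => g _.
by rewrite rmorphM rmorph_sign rmorphXn hX -cs exprD !mulrA.
Qed.

Lemma enumerator_atE (E : finType) (M : matroid E) (x y z : ratfun) :
  enumerator_at M x y z =
  \sum_(s : {set E}) \sum_(g : {set E} | g \subset s)
    (-1) ^+ (#|s| + #|g|) * z ^+ nullity M g * (x ^+ (#|E| - #|s|) * y ^+ #|s|).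
Proof.
pose f : {rmorphism {mpoly int[3]} -> ratfun} :=
  (meval (tnth [tuple x; y; z]) \o map_mpoly intr).
have fX i : f 'X_i = tnth [tuple x; y; z] i by rewrite /f /= map_mpolyX mevalXU.
rewrite -[LHS]/(f (enumerator M)) rmorph_enumerator.
by rewrite !fX !(tnth_nth 0).
Qed.

Theorem theorem4 (E : finType) (M : matroid E) (n k : nat)
    (hn : #|E| = n) (hk : rank M [set: E] = k) :
  let X : ratfun := tofrac 'X_0 in
  let Y : ratfun := tofrac 'X_1 in
  tofrac (tutte M) =
    (X - 1) ^- (n - k) * X ^+ n
      * enumerator_at M 1 X^-1 ((X - 1) * (Y - 1)).
Proof.
move=> X Y.
have var_neq (c : int) : 'X_0 != c%:MP_[2].
  (* Evaluation at [c + 1] would turn the equality into 1 = 0. The cases c = 0 and c = 1 make [X]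
     and [X - 1] invertible. *)
  apply/negP => /eqP /(congr1 (meval (fun=> c + 1))) /eqP.
  by rewrite mevalXU mevalC -subr_eq0 addrAC subrr.
have X0 : X != 0 by rewrite /X tofrac_eq0 -mpolyC0 var_neq.
have X1 : X - 1 != 0.
  by rewrite /X -tofrac1 -tofracB tofrac_eq0 subr_eq0 -mpolyC1 var_neq.
rewrite enumerator_atE (exchange_big_dep predT) //= mulr_sumr rmorph_sum.
apply: eq_bigr => g _.
have gn : (#|g| <= n)%N by rewrite -hn max_card.
have rg : (rank M g <= #|g|)%N := rank_le_card E M g.
have rk : (rank M g <= k)%N by rewrite -hk rank_subset ?subsetT.
have kn : (k <= n)%N by rewrite -hk -hn -cardsT rank_le_card.
(* The term of [g] once its inner sum over [s] has been evaluated. *)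
transitivity ((X - 1) ^- (n - k) * ((X - 1) * (Y - 1)) ^+ nullity M g
    * (X - 1) ^+ (n - #|g|)).
  rewrite rmorphM !rmorphXn !rmorphB !rmorph1 hk -/X -/Y /nullity exprMn.
  have -> : (X - 1) ^+ (k - rank M g) = (X - 1) ^- (n - k)
      * ((X - 1) ^+ (#|g| - rank M g) * (X - 1) ^+ (n - #|g|)).
    (* With the inverse cleared, both exponents equal n - r(g); the four inequalities above make
       every subtraction genuine. *)
    apply: (mulfI (expf_neq0 (n - k) X1)).
    by rewrite mulVKf ?expf_neq0 // -!exprD [in RHS]addnC !addnBA // !subnK.
  by rewrite -!mulrA; congr (_ * (_ * _)); rewrite mulrC.
rewrite -!mulrA; congr (_ * _).
rewrite -hn -sum_supset_signed_exp !mulr_sumr; apply: eq_bigr => s _.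
rewrite expr1n mul1r exprVn.
have -> : X ^+ (#|E| - #|s|) = X ^+ #|E| / X ^+ #|s|.
  by rewrite exprB ?max_card // unitfE X0.
by rewrite mulrCA mulrA mulrCA.
Qed.
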